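(* Let $n=2^{c}+2^{b}+2^{a}$ where $c>b>a\ge 0$ are integers, and let $s$ be an odd positive integer. Assume that $s$ divides the three binomial coefficients $\binom{n}{2^{a}}$, $\binom{n}{2^{b}}$ and $\binom{n}{2^{c}}$. Assume furthermore that there is an integer $k$ with $1\le k\le n-1$ which is non-essential for $n$ in base $2$, that is, $k\notin\{2^{a},2^{b},2^{a}+2^{b},2^{c},2^{c}+2^{a},2^{c}+2^{b}\}$, such that $s$ divides $\binom{n}{k}$. Then the cyclotomic polynomial $\Phi_{2s}$ is a factor of the descent set polynomial $Q_{n}(t)$.
   Context: For a permutation $\pi$ in the symmetric group $\mathfrak{S}_n$, its descent set is $\mathrm{Des}(\pi)=\{i\in[n-1] : \pi_i>\pi_{i+1}\}$, where $[n-1]=\{1,\dots,n-1\}$. For $S\subseteq[n-1]$ let $\beta_n(S)=|\{\pi\in\mathfrak{S}_n : \mathrm{Des}(\pi)=S\}|$. The $n$th descent set polynomial is $Q_n(t)=\sum_{S\subseteq[n-1]}t^{\beta_n(S)}$. $\Phi_m(t)$ denotes the $m$th cyclotomic polynomial; factors are in $\mathbb{Q}[t]$. For a prime $p$ and $1\le k\le n-1$, write $n=\sum_i n_ip^i$, $k=\sum_i k_ip^i$ with $0\le n_i,k_i<p$; $k$ is essential for $n$ in base $p$ if $k_i\le n_i$ for all $i$, and non-essential otherwise. *)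

(* Defs.v *)
From mathcomp Require Import all_boot all_order all_fingroup all_algebra all_field.

Set Implicit Arguments.
Unset Strict Implicit.
Unset Printing Implicit Defensive.

Import GRing.Theory.
Local Open Scope ring_scope.

(* Positions and values are 0-based: permutations act on {0, ..., n-1}, and
   i : 'I_n.-1 stands for the element i + 1 of [n-1] = {1, ..., n-1}.  Thus
   desl i and desr i are the two adjacent positions compared at i. *)
Lemma desr_subproof n (i : 'I_n.-1) : (i.+1 < n)%N.
Proof. by case: n i => [|n] []. Qed.

Definition desr n (i : 'I_n.-1) : 'I_n := Ordinal (desr_subproof i).
Definition desl n (i : 'I_n.-1) : 'I_n := widen_ord (leq_pred n) i.

Definition Des n (pi : 'S_n) : {set 'I_n.-1} :=
  [set i : 'I_n.-1 | (pi (desr i) < pi (desl i))%N].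

Definition beta n (S : {set 'I_n.-1}) : nat := #|[set pi : 'S_n | Des pi == S]|.

Definition descent_poly n : {poly rat} :=
  \sum_(S : {set 'I_n.-1}) 'X^(beta S).

(* MathComp's 'Phi_m has integer coefficients; this is its image in Q[t]. *)
Definition CyclotomicQ m : {poly rat} := map_poly intr 'Phi_m.

Definition digit (p n i : nat) : nat := ((n %/ p ^ i) %% p)%N.

Definition essential (p n k : nat) : Prop :=
  forall i, (digit p k i <= digit p n i)%N.

(* Main.v *)
(** Forgetting whether k is a descent gives
      beta_n(S) + beta_n(S + {k}) = C(n,k) beta_k(S below k) beta_(n-k)(S above k),
    where S + {k} is the symmetric difference.  So toggling k negates beta_n(S)
    modulo any divisor of C(n,k), and changes its parity exactly when the right
    hand side is odd.  For k = 2^i with {i,j,l} = {a,b,c} this happens iff S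
    contains both or neither of 2^i + 2^j and 2^i + 2^l.  These three sums cannot
    fail the condition for all of i = a, b, c, by parity, so some i = i(S)
    satisfies it.  Toggling both 2^i(S) and a non-essential k with s | C(n,k) is
    an involution on the sets S which preserves beta_n(S) modulo s and flips its
    parity, hence negates zeta^(beta_n(S)) for zeta a primitive 2s-th root of
    unity.  Thus Q_n(zeta) = - Q_n(zeta). *)

Require Import Defs.
From mathcomp Require Import all_boot all_order all_fingroup all_algebra all_field.
From mathcomp Require Import zify.

Set Implicit Arguments.
Unset Strict Implicit.
Unset Printing Implicit Defensive.

Import GRing.Theory.

(** * Binomial coefficients modulo 2 *)

(** Applying Pascal's rule twice produces the middle term ['C(m.*2, l.*2.+1)] twice, so it cancels
    modulo 2. *)
Lemma odd_bin_double m l : odd 'C(m.*2, l.*2) = odd 'C(m, l).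
Proof.
elim: m l => [|m IHm] [|l]; rewrite ?bin0 //.
rewrite doubleS (doubleS l) 2!binS (binS m.*2) (binS m) !oddD -(IHm l) -(IHm l.+1) doubleS.
by rewrite -!addbA addKb.
Qed.

Lemma odd_bin_double_succ m l : odd 'C(m.*2, l.*2.+1) = false.
Proof.
(* In [(2l+1) C(2m,2l+1) = (2m-2l) C(2m,2l)] the left factor is odd and the right side even. *)
have := congr1 odd (mul_bin_left m.*2 l.*2).
by rewrite !oddM oddS odd_double /= => ->; rewrite -doubleB odd_double.
Qed.

(** One binary digit of Lucas' theorem; iterating it compares all digits. *)
Lemma odd_bin_half n k : odd 'C(n, k) = (odd k ==> odd n) && odd 'C(n./2, k./2).
Proof.
rewrite -{1}[n]odd_double_half -{1}[k]odd_double_half.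
case: (odd n); case: (odd k); rewrite ?add0n ?add1n /= ?odd_bin_double ?odd_bin_double_succ //.
- by rewrite binS oddD odd_bin_double_succ odd_bin_double.
- case: (k./2) => [|l]; first by rewrite !bin0.
  by rewrite doubleS binS oddD odd_bin_double_succ addbF -doubleS odd_bin_double.
Qed.

Lemma essential_odd_bin n k : odd 'C(n, k) -> essential 2 n k.
Proof.
move=> + i; elim: i n k => [|i IHi] n k; rewrite odd_bin_half => /andP[kn Ck].
  by rewrite /digit !expn0 !divn1 !modn2; move: kn; do 2!case: odd.
by have := IHi _ _ Ck; rewrite /digit !expnS -!divn2 -!divnMA.
Qed.

Lemma odd_bin_exp2 i k : odd 'C(2 ^ i, k) = (k == 0) || (k == 2 ^ i).
Proof.
elim: i k => [|i IHi] k; first by case: k => [|[|k]].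
rewrite odd_bin_half expnS mul2n odd_double doubleK implybF IHi.
rewrite -[k in RHS]odd_double_half.
case: (odd k) => /=; last by rewrite add0n double_eq0 -!mul2n eqn_pmul2l.
by apply/esym/negbTE/eqP=> /(congr1 odd); rewrite add1n /= !odd_double.
Qed.

(** This is [(1+x)^(2^c+m) = (1+x^(2^c)) (1+x)^m] modulo 2: in Vandermonde's sum only the indices
    [0] and [2 ^ c] give an odd first factor. *)
Lemma odd_bin_exp2D c m k :
  odd 'C(2 ^ c + m, k) = odd 'C(m, k) (+) ((2 ^ c <= k) && odd 'C(m, k - 2 ^ c)).
Proof.
rewrite -binomial.Vandermonde big_ord_recl /= bin0 mul1n subn0 oddD; congr (_ (+) _).
case: leqP => [le_ck | lt_kc] /=.
  have gt0 : 0 < 2 ^ c by rewrite expn_gt0.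
  have lt_c : (2 ^ c).-1 < k by rewrite prednK.
  rewrite (bigD1 (Ordinal lt_c)) //= /bump leq0n add1n prednK // binn mul1n.
  rewrite oddD (big_morph odd oddD (erefl _)) big1 ?addbF // => i ne_i.
  rewrite oddM odd_bin_exp2 /bump leq0n add1n /=.
  by case: eqP => //= e; case/eqP: ne_i; apply: val_inj => /=; rewrite -e.
rewrite (big_morph odd oddD (erefl _)) big1 // => i _.
rewrite oddM odd_bin_exp2 /bump leq0n add1n /=.
by case: eqP => //= e; have := ltn_ord i; rewrite -ltnS e ltnNge lt_kc.
Qed.

(** * Permutations as shuffles of two blocks *)

(** [enum] lists a set of ordinals increasingly, so values taken from it through [nth] keep the
    relative order of their indices. *)
Lemma enum_set_ltn_nth n (A : {set 'I_n}) x y i j :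
  i < #|A| -> j < #|A| -> (nth x (enum A) i < nth y (enum A) j) = (i < j).
Proof.
rewrite !cardE => lti ltj; rewrite (set_nth_default x y ltj).
have sA : sorted (relpre val ltn) (enum A).
  rewrite /enum_mem; apply: sorted_filter; first by move=> ? ? ?; apply: ltn_trans.
  by rewrite -enumT -sorted_map val_enum_ord iota_ltn_sorted.
have mono u v : u < v -> v < size (enum A) -> nth x (enum A) u < nth x (enum A) v.
  move=> uv vA; apply: (sorted_ltn_nth _ x sA) => //; rewrite ?inE //.
    by move=> ? ? ?; apply: ltn_trans.
  exact: ltn_trans vA.
case: (ltngtP i j) => [ij|ji|->]; rewrite ?ltnn //; first exact: mono.
by apply/negbTE; rewrite -leqNgt ltnW // mono.
Qed.

Section Shuffle.

Variables k m : nat.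
Implicit Types (A : {set 'I_(k + m)}) (sg : 'S_k) (ta : 'S_m).

(* The permutation mapping the first k positions to A and the last m to its
   complement, in the relative orders prescribed by sg and ta. *)
Definition shuffle_fun (t : {set 'I_(k + m)} * 'S_k * 'S_m) : {ffun 'I_(k + m) -> 'I_(k + m)} :=
  [ffun i : 'I_(k + m) => match split i with
   | inl x => nth i (enum t.1.1) (t.1.2 x)
   | inr y => nth i (enum (~: t.1.1)) (t.2 y) end].

(** The identity is a default for triples whose [shuffle_fun] is not injective; it never occurs when
    the set has [k] elements. *)
Definition shuffle t : 'S_(k + m) := insubd (1%g : 'S_(k + m)) (shuffle_fun t).

Lemma card_setC_shuffle A : #|A| = k -> #|~: A| = m.
Proof. by move=> cA; rewrite cardsCs setCK card_ord cA addKn. Qed.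

Lemma shuffle_fun_inj A sg ta : #|A| = k -> injective (shuffle_fun (A, sg, ta)).
Proof.
move=> cA; have cA' := card_setC_shuffle cA.
have inA i x : nth i (enum A) (sg x) \in A.
  by rewrite -mem_enum mem_nth // -cardE cA.
have inA' i x : nth i (enum (~: A)) (ta x) \in ~: A.
  by rewrite -mem_enum mem_nth // -cardE cA'.
move=> i j; rewrite !ffunE /=.
case: splitP => x ei; case: splitP => y ej.
- have lt z : sg z < size (enum A) by rewrite -cardE cA.
  rewrite (set_nth_default i j) // => /eqP.
  rewrite nth_uniq ?enum_uniq // => /eqP/val_inj/perm_inj exy.
  by apply: val_inj => /=; rewrite ei ej exy.
- by move=> e; have := inA i x; rewrite e; have:= inA' j y; rewrite inE => /negbTE->.
- by move=> e; have := inA j y; rewrite -e; have:= inA' i x; rewrite inE => /negbTE->.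
- have lt z : ta z < size (enum (~: A)) by rewrite -cardE cA'.
  rewrite (set_nth_default i j) // => /eqP.
  rewrite nth_uniq ?enum_uniq // => /eqP/val_inj/perm_inj exy.
  by apply: val_inj => /=; rewrite ei ej exy.
Qed.

Lemma shuffleE A sg ta : #|A| = k -> shuffle (A, sg, ta) =1 shuffle_fun (A, sg, ta).
Proof.
move=> cA i; rewrite -pvalE /shuffle.
by rewrite -[pval _]/(val _) val_insubd; move/injectiveP: (@shuffle_fun_inj A sg ta cA) => ->.
Qed.

Lemma shuffle_lshift A sg ta x z : #|A| = k ->
  shuffle (A, sg, ta) (lshift m x) = nth z (enum A) (sg x).
Proof.
move=> cA; rewrite shuffleE // ffunE (unsplitK (inl _ x)) /=.
by apply: set_nth_default; rewrite -cardE cA.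
Qed.

Lemma shuffle_rshift A sg ta y z : #|A| = k ->
  shuffle (A, sg, ta) (rshift k y) = nth z (enum (~: A)) (ta y).
Proof.
move=> cA; rewrite shuffleE // ffunE (unsplitK (inr _ y)) /=.
by apply: set_nth_default; rewrite -cardE card_setC_shuffle.
Qed.

Definition shuffle_dom : {set {set 'I_(k + m)} * 'S_k * 'S_m} :=
  [set t : {set 'I_(k + m)} * 'S_k * 'S_m | #|t.1.1| == k].

(** Recovers [A] from the permutation, the first step towards injectivity of [shuffle]. *)
Lemma shuffle_image A sg ta : #|A| = k ->
  [set shuffle (A, sg, ta) (lshift m x) | x : 'I_k] = A.
Proof.
move=> cA; apply/eqP; rewrite eqEcard card_imset ?card_ord ?cA ?leqnn ?andbT; last first.
  by apply: inj_comp; [apply: perm_inj | apply: lshift_inj].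
apply/subsetP=> _ /imsetP[x _ ->]; rewrite (shuffle_lshift _ _ _ (lshift m x) cA).
by rewrite -mem_enum mem_nth // -cardE cA.
Qed.

Lemma shuffle_inj : {in shuffle_dom &, injective shuffle}.
Proof.
move=> [[A sg] ta] [[B sg'] ta']; rewrite !inE /= => /eqP cA /eqP cB eAB.
have eA : A = B by rewrite -(shuffle_image sg ta cA) -(shuffle_image sg' ta' cB) eAB.
subst B; congr (_, _, _); apply/permP=> x; apply: val_inj.
  have := shuffle_lshift sg ta x (lshift m x) cA.
  rewrite eAB (shuffle_lshift _ _ _ (lshift m x) cA) => /eqP.
  by rewrite nth_uniq ?enum_uniq -?cardE ?cA // => /eqP.
have := shuffle_rshift sg ta x (rshift k x) cA.
rewrite eAB (shuffle_rshift _ _ _ (rshift k x) cA) => /eqP.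
by rewrite nth_uniq ?enum_uniq -?cardE ?card_setC_shuffle // => /eqP.
Qed.

(* Injectivity suffices, since C(k+m,k) k! m! = (k+m)!. *)
Lemma shuffle_surj pi : exists2 t, t \in shuffle_dom & pi = shuffle t.
Proof.
suff /imsetP[t tD ->] : pi \in shuffle @: shuffle_dom by exists t.
suff -> : shuffle @: shuffle_dom = setT by rewrite inE.
apply/eqP; rewrite eqEcard subsetT card_in_imset; last exact: shuffle_inj.
have -> : shuffle_dom = setX (setX [set A : {set 'I_(k + m)} | #|A| == k] setT) setT.
  by apply/setP=> -[[A sg] ta]; rewrite !inE !andbT.
rewrite !cardsX card_draws !cardsT !card_Sn card_ord.
by rewrite -{1}(bin_fact (leq_addr m k)) addKn mulnA leqnn.
Qed.

End Shuffle.

(** * Toggling one element of a descent set *)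

(* As in Defs, the predicate value at i stands for the element i + 1 of [n-1];
   hence the predecessors k.-1 below. *)
Definition beta_pred n (P : pred nat) : nat := beta [set i : 'I_n.-1 | P i].

Definition toggle (x : nat) (P : pred nat) : pred nat :=
  fun i => (i == x) (+) P i.

Lemma eq_beta_pred n (P Q : pred nat) :
  (forall i, i < n.-1 -> P i = Q i) -> beta_pred n P = beta_pred n Q.
Proof. by move=> eqPQ; congr beta; apply/setP=> i; rewrite !inE eqPQ. Qed.

Lemma Des_eqP n (P : pred nat) (pi : 'S_n) :
  reflect (forall i j : 'I_n, j = i.+1 :> nat -> (pi j < pi i) = P i)
          (Des pi == [set i : 'I_n.-1 | P i]).
Proof.
apply: (iffP eqP) => [/setP eqD i j eji | eqP].
  have lt_i : i < n.-1 by have := ltn_ord j; lia.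
  have := eqD (Ordinal lt_i); rewrite !inE /=.
  have -> : desr (Ordinal lt_i) = j by apply: val_inj; rewrite /= eji.
  by have -> : desl (Ordinal lt_i) = i by apply: val_inj.
by apply/setP=> i; rewrite !inE (eqP (desl i)).
Qed.

(** Inside each block the comparisons are those of [sg] or [ta]. The excluded case [j = k] is the
    pair of positions straddling the two blocks. *)
Lemma Des_shuffle k m (A : {set 'I_(k + m)}) (sg : 'S_k) (ta : 'S_m) P :
  #|A| = k ->
  (Des sg == [set i : 'I_k.-1 | P (val i)]) &&
    (Des ta == [set i : 'I_m.-1 | P (k + val i)]) =
  [forall i : 'I_(k + m), forall j : 'I_(k + m),
     (j == i.+1 :> nat) && (j != k :> nat) ==>
     ((shuffle (A, sg, ta) j < shuffle (A, sg, ta) i) == P i)].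
Proof.
move=> cA; apply/idP/idP => [/andP[/Des_eqP Dsg /(Des_eqP (fun i => P (k + i))) Dta]|H].
  apply/'forall_forallP=> i j; apply/implyP=> /andP[/eqP eji nej]; apply/eqP.
  case: (split_ordP i) eji nej => x -> /=; case: (split_ordP j) => y -> /=.
  - move=> eyx _; rewrite !(shuffle_lshift _ _ _ (lshift m x)) //.
    by rewrite enum_set_ltn_nth ?cA ?ltn_ord // Dsg.
  - by have := ltn_ord x; lia.
  - by have := ltn_ord y; lia.
  move=> eyx _; rewrite !(shuffle_rshift _ _ _ (rshift k x)) //.
  by rewrite enum_set_ltn_nth ?card_setC_shuffle ?ltn_ord // Dta //; lia.
have {}H (i j : 'I_(k + m)) : j = i.+1 :> nat -> j != k :> nat ->
    (shuffle (A, sg, ta) j < shuffle (A, sg, ta) i) = P i.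
  by move=> e ne; move/'forall_forallP/(_ i j): H; rewrite e eqxx -e ne => /eqP.
apply/andP; split.
  apply/Des_eqP=> x y eyx; have := H (lshift m x) (lshift m y) eyx.
  rewrite !(shuffle_lshift _ _ _ (lshift m x)) // enum_set_ltn_nth ?cA ?ltn_ord //.
  by apply; have := ltn_ord y; rewrite /=; lia.
apply/(Des_eqP (fun i => P (k + i)))=> x y eyx.
have := H (rshift k x) (rshift k y).
rewrite !(shuffle_rshift _ _ _ (rshift k x)) //.
by rewrite enum_set_ltn_nth ?card_setC_shuffle ?ltn_ord // /=; apply; lia.
Qed.

(** Both sides count the permutations satisfying [off], which prescribes every comparison except the
    one between the blocks: the left side splits on that comparison, the right side decomposes into
    shuffles. *)
Lemma beta_toggle_shuffle k m P : 0 < k -> 0 < m ->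
  beta_pred (k + m) P + beta_pred (k + m) (toggle k.-1 P) =
  'C(k + m, k) * beta_pred k P * beta_pred m (fun i => P (k + i)).
Proof.
move=> k_gt0 m_gt0.
pose off (pi : 'S_(k + m)) := [forall i : 'I_(k + m), forall j : 'I_(k + m),
     (j == i.+1 :> nat) && (j != k :> nat) ==> ((pi j < pi i) == P i)].
have lt_k : k.-1 < (k + m).-1 by lia.
pose x := Ordinal lt_k.
transitivity #|[set pi | off pi]|.
  rewrite /beta_pred /beta -cardsUI.
  (* The two classes are disjoint, since they disagree about a descent at [k.-1]. *)
  rewrite [_ :&: _](_ : _ = set0); last first.
    apply/setP=> pi; rewrite !inE; apply/negbTE/negP => /andP[/eqP-> /eqP/setP].
    by move/(_ x); rewrite !inE /toggle eqxx; case: (P _).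
  rewrite cards0 addn0; apply: eq_card => pi; rewrite !inE.
  apply/orP/'forall_forallP => [H i j|H].
    apply/implyP=> /andP[/eqP eji nej]; apply/eqP.
    case: H => [/Des_eqP|/(Des_eqP (toggle k.-1 P))] /(_ _ _ eji) -> //.
    by rewrite /toggle; case: eqP => // e; rewrite eji e prednK ?eqxx in nej.
  have {}H (i j : 'I_(k + m)) : j = i.+1 :> nat -> j != k :> nat ->
    (pi j < pi i) = P i.
    by move=> e ne; have := H i j; rewrite e eqxx -e ne => /eqP.
  case: (boolP ((pi (desr x) < pi (desl x)) == P k.-1)) => [/eqP e|ne]; [left|right].
    apply/Des_eqP => i j eji; have [ejk|] := eqVneq (j : nat) k; last exact: H.
    have -> : j = desr x by apply: val_inj; rewrite /= ejk prednK.
    have -> : i = desl x by apply: val_inj; rewrite /=; lia.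
    by rewrite e.
  apply/(Des_eqP (toggle k.-1 P)) => i j eji; rewrite /toggle.
  have [ejk|ne_jk] := eqVneq (j : nat) k.
    have -> : j = desr x by apply: val_inj; rewrite /= ejk prednK.
    have -> : i = desl x by apply: val_inj; rewrite /=; lia.
    by rewrite /= eqxx; move: ne; case: (P _); case: (_ < _).
  rewrite H //; case: eqP => // e; case/eqP: ne_jk; lia.
pose D := setX (setX [set A : {set 'I_(k + m)} | #|A| == k]
    [set sg : 'S_k | Des sg == [set i : 'I_k.-1 | P (val i)]])
    [set ta : 'S_m | Des ta == [set i : 'I_m.-1 | P (k + val i)]].
have -> : [set pi | off pi] = @shuffle k m @: D.
  apply/setP=> pi; rewrite inE; apply/idP/imsetP => [off_pi|].
    have [[[A sg] ta]] := shuffle_surj pi; rewrite inE /= => /eqP cA def_pi.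
    exists (A, sg, ta) => //; rewrite !inE /= cA eqxx /=.
    by rewrite (Des_shuffle _ _ _ cA) -def_pi.
  case=> -[[A sg] ta]; rewrite !inE -andbA => /andP[/eqP cA +] ->.
  by rewrite (Des_shuffle _ _ _ cA).
rewrite card_in_imset; last first.
  move=> t u; rewrite !inE -!andbA => /andP[tD _] /andP[uD _].
  by apply: shuffle_inj; rewrite inE.
by rewrite !cardsX card_draws card_ord.
Qed.

(** * Parity of descent set counts *)

Lemma beta_pred0 n : beta_pred n xpred0 = 1.
Proof.
apply/eqP/cards1P; exists 1%g; apply/setP=> pi; rewrite !inE.
apply/(Des_eqP xpred0)/eqP => [incr|-> i j e]; last by rewrite !perm1 e ltnNge leqnSn.
(* Without descents [pi] is strictly increasing: climbing from position 0 bounds it below by the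
   identity, and going down from the last position bounds it above. *)
have le_pi (i : nat) : forall (lt_i : i < n), i <= pi (Ordinal lt_i).
  elim: i => // i IHi lt_i; have lt_i' := ltnW lt_i.
  apply: leq_ltn_trans (IHi lt_i') _.
  have := incr (Ordinal lt_i') (Ordinal lt_i) erefl.
  move=> /negbT; rewrite -leqNgt leq_eqVlt => /orP[|//].
  by move=> /eqP/val_inj/perm_inj/(congr1 val)/= /n_Sn.
have ge_pi (d : nat) : forall i : 'I_n, i + d = n.-1 -> pi i <= i.
  elim: d => [|d IHd] i e; first by have := ltn_ord (pi i); lia.
  have lt_i : i.+1 < n by have := ltn_ord i; lia.
  have := IHd (Ordinal lt_i); rewrite /= => /(_ ltac:(lia)).
  have := incr i (Ordinal lt_i) erefl => /negbT; rewrite -leqNgt leq_eqVlt.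
  by case/orP=> [/eqP/val_inj/perm_inj/(congr1 val)/= /n_Sn//|]; lia.
apply/permP=> i; rewrite perm1; apply/val_inj/eqP.
rewrite eqn_leq (ge_pi (n.-1 - i)) //=; last by have := ltn_ord i; lia.
by have := le_pi i (ltn_ord i); congr (_ <= pi _); apply: val_inj.
Qed.

Lemma odd_beta_toggle k m P : 0 < k -> 0 < m ->
  odd (beta_pred (k + m) (toggle k.-1 P)) = odd (beta_pred (k + m) P) (+)
   [&& odd 'C(k + m, k), odd (beta_pred k P) & odd (beta_pred m (fun i => P (k + i)))].
Proof.
move=> k_gt0 m_gt0; have /(congr1 odd) := beta_toggle_shuffle P k_gt0 m_gt0.
by rewrite oddD !oddM -andbA => <-; rewrite addbA addbb.
Qed.

(** Starting from the empty set, whose count is 1, add the elements of [P] in increasing order.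
    Adding [j] flips the parity exactly when ['C(n, j.+1)] is odd, as both smaller counts are then
    odd by hypothesis. *)
Lemma odd_beta_pred n P :
    (forall k Q, 0 < k < n -> odd 'C(n, k) -> odd (beta_pred k Q)) ->
  odd (beta_pred n P) = ~~ odd (\sum_(i < n.-1) (P i && odd 'C(n, i.+1))).
Proof.
move=> odd_parts.
suff H j : j <= n.-1 -> odd (beta_pred n (fun i => (i < j) && P i)) =
     ~~ odd (\sum_(i < j) (P i && odd 'C(n, i.+1))).
  by rewrite -H //; congr odd; apply: eq_beta_pred => i ->.
elim: j => [_|j IHj lt_j].
  by rewrite big_ord0 (@eq_beta_pred _ _ xpred0) ?beta_pred0.
rewrite big_ord_recr oddD /= -addNb -{}IHj ?(ltnW lt_j) //.
set Q := fun i => (i < j) && P i.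
case Pj: (P j) => /=; last first.
  rewrite addbF; congr odd; apply: eq_beta_pred => i _; rewrite /Q ltnS leq_eqVlt.
  by case: eqP => [->|]; rewrite ?Pj ?andbF.
transitivity (odd (beta_pred n (toggle j Q))).
  congr odd; apply: eq_beta_pred => i _; rewrite /toggle /Q ltnS leq_eqVlt.
  by case: eqP => [->|//]; rewrite ?Pj ltnn.
have def_n : n = j.+1 + (n - j.+1) by lia.
have m_gt0 : 0 < n - j.+1 by lia.
have := odd_beta_toggle Q (ltn0Sn j) m_gt0; rewrite -def_n => -> /=.
rewrite oddb; case C: (odd 'C(n, j.+1)) => //=.
(* The upper part falls under the hypothesis by the symmetry of binomial coefficients. *)
rewrite (odd_parts j.+1) ?(odd_parts (n - j.+1)) ?bin_sub ?C ?addbT //; lia.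
Qed.

Lemma odd_beta_exp2 i P : odd (beta_pred (2 ^ i) P).
Proof.
have no_odd k : 0 < k < 2 ^ i -> odd 'C(2 ^ i, k) = false.
  by move=> k_in; rewrite odd_bin_exp2; lia.
rewrite odd_beta_pred => [|k Q k_in]; last by rewrite no_odd.
rewrite big1 // => j _; rewrite no_odd ?andbF //.
by have := ltn_ord j; lia.
Qed.

Lemma odd_bin_exp2_2 i j k : i < j ->
  odd 'C(2 ^ j + 2 ^ i, k) =
    [|| k == 0, k == 2 ^ i, k == 2 ^ j | k == 2 ^ j + 2 ^ i].
Proof.
move=> ij; have : 2 ^ i < 2 ^ j by rewrite ltn_exp2l.
have : 0 < 2 ^ i by rewrite expn_gt0.
by rewrite odd_bin_exp2D !odd_bin_exp2; lia.
Qed.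

(** The only interior odd binomial coefficients are at [2 ^ i] and [2 ^ j], and both parts are then
    powers of two, with odd counts. *)
Lemma odd_beta_exp2_2 i j P : i < j ->
  odd (beta_pred (2 ^ j + 2 ^ i) P) = ~~ (P (2 ^ i).-1 (+) P (2 ^ j).-1).
Proof.
move=> ij; have lt_ij : 2 ^ i < 2 ^ j by rewrite ltn_exp2l.
have i_gt0 : 0 < 2 ^ i by rewrite expn_gt0.
rewrite odd_beta_pred => [|k Q k_in]; last first.
  rewrite odd_bin_exp2_2 // => /or4P[] /eqP ek; rewrite ?ek ?odd_beta_exp2 //; lia.
have lti : (2 ^ i).-1 < (2 ^ j + 2 ^ i).-1 by lia.
have ltj : (2 ^ j).-1 < (2 ^ j + 2 ^ i).-1 by lia.
rewrite (bigD1 (Ordinal lti)) //= (bigD1 (Ordinal ltj)) //=; last first.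
  by apply/eqP=> /(congr1 val)/=; lia.
rewrite !prednK //; last by lia.
rewrite !odd_bin_exp2_2 // !eqxx !orbT !andbT big1 ?addn0 ?oddD ?oddb // => k.
move=> /andP[/eqP ne_i /eqP ne_j].
have {}ne_i : k <> (2 ^ i).-1 :> nat by move=> e; apply/ne_i/val_inj.
have {}ne_j : k <> (2 ^ j).-1 :> nat by move=> e; apply/ne_j/val_inj.
have := ltn_ord k; rewrite odd_bin_exp2_2 //; move=> lt_k.
by rewrite [X in _ && X](_ : _ = false) ?andbF //; lia.
Qed.

Lemma dvdn_beta_toggle n k d P : 0 < k < n -> d %| 'C(n, k) ->
  d %| beta_pred n P + beta_pred n (toggle k.-1 P).
Proof.
move=> /andP[k_gt0 lt_kn] dC; have m_gt0 : 0 < n - k by rewrite subn_gt0.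
have := beta_toggle_shuffle P k_gt0 m_gt0; rewrite subnKC ?(ltnW lt_kn) // => ->.
by rewrite -mulnA dvdn_mulr.
Qed.

(** The lower part, of size [2 ^ i], has an odd count; the upper one, of size [2 ^ j + 2 ^ l], sees
    [P] shifted by [2 ^ i], whence the sums of two powers. *)
Lemma odd_beta_toggle_exp2 n i j l P : l < j -> n = 2 ^ i + (2 ^ j + 2 ^ l) ->
    odd 'C(n, 2 ^ i) ->
  odd (beta_pred n (toggle (2 ^ i).-1 P)) =
    odd (beta_pred n P) (+) ~~ (P (2 ^ i + 2 ^ l).-1 (+) P (2 ^ i + 2 ^ j).-1).
Proof.
move=> lj -> C; have gt0 e : 0 < 2 ^ e by rewrite expn_gt0.
rewrite odd_beta_toggle ?addn_gt0 ?gt0 // C odd_beta_exp2 odd_beta_exp2_2 //=.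
have shift e : 2 ^ i + (2 ^ e).-1 = (2 ^ i + 2 ^ e).-1.
  by rewrite -!subn1 addnBA.
by rewrite !shift.
Qed.

(** * Sets as predicates, and roots of unity *)

Definition pred_of_pos n (S : {set 'I_n.-1}) : pred nat :=
  [pred i | i \in [seq val j | j in S]].

Definition set_of_pred n (P : pred nat) : {set 'I_n.-1} := [set i | P (val i)].

Lemma pred_of_posK n (P : pred nat) i :
  i < n.-1 -> pred_of_pos (set_of_pred n P) i = P i.
Proof.
move=> lt_i; apply: etrans (mem_image val_inj _ (Ordinal lt_i)) _.
by rewrite inE.
Qed.

Lemma set_of_predK n (S : {set 'I_n.-1}) : set_of_pred n (pred_of_pos S) = S.
Proof. by apply/setP=> i; rewrite inE; apply: (mem_image val_inj). Qed.

(** By the Chinese remainder theorem [i] is congruent to [s + j] modulo [2 * s], and [z ^+ s] is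
    -1. *)
Lemma expr_half_root (R : idomainType) (z : R) s i j : odd s ->
    ((2 * s).-primitive_root z)%R -> i = j %[mod s] -> odd i != odd j ->
  (z ^+ i = - z ^+ j)%R.
Proof.
move=> s_odd z_prim eq_s ne_odd.
have s_gt0 : 0 < s by case: s s_odd {z_prim eq_s}.
have zs : (z ^+ s = -1)%R.
  (* [z ^+ s] squares to 1 but is not 1, because the order [2 * s] does not divide [s]. *)
  apply/eqP; have := prim_expr_order z_prim; rewrite mulnC exprM => /eqP.
  rewrite sqrf_eq1 => /orP[|//]; rewrite -(prim_order_dvd z_prim) => /dvdn_leq.
  by move/(_ s_gt0); lia.
rewrite -mulN1r -zs -exprD; apply/eqP; rewrite (eq_prim_root_expr z_prim).
rewrite chinese_remainder ?coprime2n // modnDl eq_s eqxx andbT.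
by rewrite !modn2 oddD s_odd; move: ne_odd; do 2!case: odd.
Qed.

(** The minimal polynomial of [z] over the rationals is the cyclotomic polynomial. *)
Lemma CyclotomicQ_dvd m (z : algC) (p : {poly rat}) :
    (m.-primitive_root z)%R -> root (map_poly ratr p) z ->
  (CyclotomicQ m %| p)%R.
Proof.
move=> z_prim; have [q [def_q _] dvd_q] := minCpolyP z.
rewrite dvd_q; suff -> : CyclotomicQ m = q by [].
apply: (map_poly_inj (ratr : rat -> algC)); rewrite -def_q (minCpoly_cyclotomic z_prim).
rewrite -(Cintr_Cyclotomic z_prim) /CyclotomicQ -map_poly_comp.
by apply: eq_map_poly => x /=; rewrite ratr_int.
Qed.

(** * The involution for a sum of three powers of two *)

Section ThreeBits.

Variables n a b c : nat.
Hypotheses (hab : a < b) (hbc : b < c) (hn : n = 2 ^ c + 2 ^ b + 2 ^ a).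

Let lt_ab : 2 ^ a < 2 ^ b. Proof. by rewrite ltn_exp2l. Qed.
Let lt_abc : 2 ^ b + 2 ^ a < 2 ^ c.
Proof.
apply: (@leq_trans (2 ^ b.+1)); last by rewrite leq_exp2l.
by rewrite expnS mul2n -addnn ltn_add2l.
Qed.
Let a_gt0 : 0 < 2 ^ a. Proof. by rewrite expn_gt0. Qed.

Lemma odd_bin_exp2_3 k :
  k \in [:: 2 ^ a; 2 ^ b; 2 ^ c; 2 ^ b + 2 ^ a; 2 ^ c + 2 ^ a; 2 ^ c + 2 ^ b] ->
  odd 'C(n, k).
Proof.
rewrite hn -addnA odd_bin_exp2D !odd_bin_exp2_2 // inE => /predU1P[->|]; first by lia.
rewrite inE => /predU1P[->|]; first by lia.
rewrite inE => /predU1P[->|]; first by rewrite subnn; lia.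
rewrite inE => /predU1P[->|]; first by lia.
rewrite inE => /predU1P[->|]; first by rewrite addKn; lia.
by rewrite inE => /eqP->; rewrite addKn; lia.
Qed.

(** The power of two whose toggling flips the parity; the final branch is justified in
    [odd_beta_pivot]. *)
Definition pivot (P : pred nat) : nat :=
  if ~~ (P (2 ^ a + 2 ^ b).-1 (+) P (2 ^ a + 2 ^ c).-1) then 2 ^ a
  else if ~~ (P (2 ^ b + 2 ^ a).-1 (+) P (2 ^ b + 2 ^ c).-1) then 2 ^ b
  else 2 ^ c.

Lemma pivot_cases P : pivot P \in [:: 2 ^ a; 2 ^ b; 2 ^ c].
Proof. by rewrite /pivot !inE; case: ifP => _; [|case: ifP => _]; rewrite eqxx ?orbT. Qed.

Lemma pivot_gt0 P : 0 < pivot P < n.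
Proof. by have := pivot_cases P; rewrite !inE; lia. Qed.

Lemma odd_beta_pivot P :
  odd (beta_pred n (toggle (pivot P).-1 P)) = ~~ odd (beta_pred n P).
Proof.
rewrite /pivot; case: ifP => [Pa|/negbFE Pa].
  rewrite (odd_beta_toggle_exp2 (j := c) (l := b)) ?Pa ?addbT ?odd_bin_exp2_3 ?inE ?eqxx ?orbT //.
  by rewrite hn addnC.
case: ifP => [Pb|/negbFE Pb].
  rewrite (odd_beta_toggle_exp2 (j := c) (l := a)) ?Pb ?addbT ?odd_bin_exp2_3 ?inE ?eqxx ?orbT //.
  exact: ltn_trans hbc.
  by rewrite hn; lia.
rewrite (odd_beta_toggle_exp2 (j := b) (l := a)) ?odd_bin_exp2_3 ?inE ?eqxx ?orbT //; last first.
  by rewrite hn addnA.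
(* The failed tests say that [P] at [2 ^ a + 2 ^ b] differs from [P] at each of the other two sums,
   so it agrees at those two. *)
move: Pa Pb; rewrite (addnC (2 ^ b) (2 ^ a)) (addnC (2 ^ c) (2 ^ b)) (addnC (2 ^ c) (2 ^ a)).
by case: (P (_ + _).-1); case: (P (_ + _).-1); case: (P (_ + _).-1) => // _ _; rewrite /= addbT.
Qed.

(** [pivot] reads [P] only at sums of two of the powers, where the binomial coefficient is odd.
    Toggling one of the three powers, or an element with an even coefficient, therefore leaves it
    unchanged. *)
Lemma pivot_agree P Q :
    (forall i, odd 'C(n, i.+1) -> i \notin [:: (2 ^ a).-1; (2 ^ b).-1; (2 ^ c).-1] ->
       i < n.-1 -> P i = Q i) ->
  pivot P = pivot Q.
Proof.
move=> eqPQ; rewrite /pivot.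
have eq x : x \in [:: 2 ^ b + 2 ^ a; 2 ^ c + 2 ^ a; 2 ^ c + 2 ^ b] -> P x.-1 = Q x.-1.
  rewrite !inE => x_in; apply: eqPQ; rewrite ?inE.
  - by case/or3P: x_in => /eqP->; rewrite prednK ?odd_bin_exp2_3 ?inE ?eqxx ?orbT // addn_gt0 ?expn_gt0.
  - by case/or3P: x_in => /eqP->; lia.
  - by case/or3P: x_in => /eqP->; lia.
rewrite !(addnC (2 ^ a)) !(addnC (2 ^ b) (2 ^ c)).
by rewrite !eq // !inE eqxx ?orbT.
Qed.

Variables s k0 : nat.
Hypotheses (hsa : s %| 'C(n, 2 ^ a)) (hsb : s %| 'C(n, 2 ^ b)) (hsc : s %| 'C(n, 2 ^ c)).
Hypotheses (k0_in : 0 < k0 < n) (k0_even : ~~ odd 'C(n, k0)) (hsk : s %| 'C(n, k0)).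

Definition switch (P : pred nat) : pred nat := toggle k0.-1 (toggle (pivot P).-1 P).

Lemma beta_switch_mod P : beta_pred n (switch P) = beta_pred n P %[mod s].
Proof.
have dvd1 : s %| beta_pred n P + beta_pred n (toggle (pivot P).-1 P).
  apply: dvdn_beta_toggle; first exact: pivot_gt0.
  by have := pivot_cases P; rewrite !inE => /or3P[]/eqP->.
have dvd2 := dvdn_beta_toggle (toggle (pivot P).-1 P) k0_in hsk.
(* Adding the intermediate count to both sides makes each a sum divisible by [s]: two sign changes
   cancel. *)
apply/eqP; rewrite -(eqn_modDr (beta_pred n (toggle (pivot P).-1 P))).
by rewrite (eqP dvd1) addnC; exact: dvd2.
Qed.

Lemma odd_beta_switch P : odd (beta_pred n (switch P)) = ~~ odd (beta_pred n P).
Proof.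
rewrite -odd_beta_pivot /switch.
(* With divisor 2, the even ['C(n, k0)] shows that toggling [k0] keeps the parity, so only the pivot
   flips it. *)
have := dvdn_beta_toggle (toggle (pivot P).-1 P) k0_in (d := 2).
by rewrite !dvdn2 oddD => /(_ k0_even); do 2!case: odd.
Qed.

Lemma pivot_switch P Q : (forall i, i < n.-1 -> Q i = switch P i) -> pivot Q = pivot P.
Proof.
move=> defQ; apply: pivot_agree => i Ci; rewrite !inE !negb_or => /and3P[na nb nc] lt_i.
rewrite defQ // /switch /toggle.
case: eqP => [ek|_]; first by case/negP: k0_even; rewrite -[k0]prednK -?ek //; case/andP: k0_in.
case: eqP => // ei; have := pivot_cases P; rewrite !inE => /or3P[]/eqP eP;
  by rewrite ei eP eqxx in na nb nc.
Qed.

Definition switch_set (S : {set 'I_n.-1}) := set_of_pred n (switch (pred_of_pos S)).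

(** The pivot is the same before and after, so the same two commuting toggles are applied twice. *)
Lemma switch_setK : involutive switch_set.
Proof.
move=> S; rewrite -[RHS]set_of_predK; apply/setP=> i; rewrite !inE /switch.
rewrite (@pivot_switch (pred_of_pos S)) => [|j]; last exact: pred_of_posK.
rewrite /toggle pred_of_posK; last exact: (ltn_ord i).
by rewrite /switch /toggle addbCA !addKb.
Qed.

Lemma descent_poly_root (z : algC) : odd s -> ((2 * s).-primitive_root z)%R ->
  root (map_poly ratr (descent_poly n)) z.
Proof.
move=> s_odd z_prim.
have neg S : (z ^+ beta (switch_set S) = - z ^+ beta S)%R.
  apply: (expr_half_root s_odd z_prim); rewrite -{2}[S]set_of_predK.
    exact: beta_switch_mod.
  by rewrite -[beta (set_of_pred _ _)]/(beta_pred _ _) odd_beta_switch; case: odd.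
rewrite /root /descent_poly rmorph_sum horner_sum /=.
under eq_bigr => S _ do rewrite map_polyXn hornerXn.
set Z := (\sum_S _)%R; suff : (Z = - Z)%R.
  by move/eqP; rewrite -addr_eq0 -mulr2n Num.Theory.mulrn_eq0.
rewrite {1}/Z (reindex_inj (inv_inj switch_setK)) -sumrN.
by apply: eq_bigr => S _; apply: neg.
Qed.

End ThreeBits.

Local Open Scope ring_scope.

Theorem theorem6p1 (n a b c s : nat)
  (hab : (a < b)%N) (hbc : (b < c)%N)
  (hn : n = (2 ^ c + 2 ^ b + 2 ^ a)%N)
  (s_odd : odd s)
  (hsa : (s %| 'C(n, 2 ^ a))%N)
  (hsb : (s %| 'C(n, 2 ^ b))%N)
  (hsc : (s %| 'C(n, 2 ^ c))%N)
  (hk : exists k : nat,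
      [/\ (1 <= k <= n - 1)%N, ~ essential 2 n k & (s %| 'C(n, k))%N]) :
  CyclotomicQ (2 * s) %| descent_poly n.
Proof.
have [k [k_in k_ness hsk]] := hk.
have k_in' : (0 < k < n)%N by move: k_in; clear; lia.
(* Lucas' theorem turns non-essential into an even binomial coefficient. *)
have k_even : ~~ odd 'C(n, k) by apply/negP=> /essential_odd_bin.
have ms_gt0 : (0 < 2 * s)%N by rewrite muln_gt0; apply: odd_gt0.
have [z z_prim] := C_prim_root_exists ms_gt0.
apply: (CyclotomicQ_dvd z_prim).
exact: (descent_poly_root hab hbc hn hsa hsb hsc k_in' k_even hsk).
Qed.
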